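(* Let $W_1,W_2,\dots$ be i.i.d. real random variables with distribution function $F$. Assume that $F$ is invertible for $0<p<1$ (so that the inverse $F^{-1}$ is defined on $(0,1)$), that $F$ is absolutely continuous with density $f$, and that $E(W_1^2)<\infty$. Then for each $p\in(0,1)$, as $n\to\infty$, $$G_n(p)\to G(p)\quad\text{in probability},$$ where $G_n$ is the Empirical Cross-over Function of $W_1,\dots,W_n$ and $G$ is the cross-over function of $F$.
   Context: ''$F$ is invertible for $0<p<1$'' means that for every $p\in(0,1)$ there is exactly one real $w$ with $F(w)=p$, denoted $F^{-1}(p)$. Cross-over function: for $0<p<1$, $$G(p)=\mu_l+\mu_u-2F^{-1}(p),\qquad \mu_l=\mu_l(p)=\frac1p\int_0^p F^{-1}(q)\,dq,\qquad \mu_u=\mu_u(p)=\frac1{1-p}\int_p^1F^{-1}(q)\,dq .$$ Empirical Cross-over Function (ECF): let $W_{(1)}\le W_{(2)}\le\cdots\le W_{(n)}$ be the order statistics of $W_1,\dots,W_n$. For $0<p<1$ let $k$ be the integer with $\frac{k-1}{n}\le p<\frac kn$, and set $$G_n(p)=\frac1k\sum_{j=1}^kW_{(j)}-W_{(k)}+\frac1{n-k}\sum_{j=k+1}^nW_{(j)}-W_{(k+1)} .$$ This makes sense when $k\le n-1$, i.e. when $p<1-\frac1n$, which for fixed $p$ holds for all sufficiently large $n$. *)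

(* Defs.v *)
From HB Require Import structures.
From mathcomp Require Export all_boot all_order all_algebra finmap.
From mathcomp Require Export all_classical all_reals all_analysis.
Export Order.TTheory GRing.Theory Num.Theory.
Export numFieldNormedType.Exports.

Set Implicit Arguments.
Unset Strict Implicit.
Unset Printing Implicit Defensive.

Local Open Scope classical_set_scope.
Local Open Scope ring_scope.

Definition mutually_independent (d : measure_display) (T : measurableType d)
    (R : realType) (P : probability T R) (I : choiceType)
    (X : I -> {RV P >-> R}) : Prop :=
  forall (J : {fset I}) (B : I -> set R),
    (forall i, measurable (B i)) ->
    (P (\bigcap_(i in [set` J]) (X i @^-1` B i)) =
     \prod_(i <- J) P (X i @^-1` B i))%E.

Definition cvg_in_probability (d : measure_display) (T : measurableType d)
    (R : realType) (P : probability T R) (X : nat -> T -> R) (Y : T -> R) :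
    Prop :=
  forall eps : R, 0 < eps ->
    P [set t | eps <= `|X n t - Y t|] @[n --> \oo] --> 0%E.

Definition invertible01 (R : realType) (F : R -> R) : Prop :=
  forall p : R, 0 < p < 1 -> exists! w : R, F w = p.

(* Meaningful only when [F w = p] has exactly one solution; [0] is the junk
   value when it has none. *)
Definition cdf_inv (R : realType) (F : R -> R) (p : R) : R :=
  xget 0 [set w | F w = p].

Definition abs_continuous_with_density (R : realType) (F f : R -> R) : Prop :=
  [/\ measurable_fun setT f, (forall y, 0 <= f y) &
      forall x, (F x)%:E = (\int[lebesgue_measure]_(y in `]-oo, x]) (f y)%:E)%E].

(* The integrals are taken over open intervals because [F^-1] lives on ]0, 1[. *)
Definition mu_l (R : realType) (F : R -> R) (p : R) : R :=
  p^-1 * \int[lebesgue_measure]_(q in `]0, p[) cdf_inv F q.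

Definition mu_u (R : realType) (F : R -> R) (p : R) : R :=
  (1 - p)^-1 * \int[lebesgue_measure]_(q in `]p, 1[) cdf_inv F q.

Definition crossover (R : realType) (F : R -> R) (p : R) : R :=
  mu_l F p + mu_u F p - 2 * cdf_inv F p.

(* [order_stat n x j] is the [j]-th smallest of [x 0, ..., x n.-1], with ranks
   [j] counted from 1; it is meaningful for [1 <= j <= n]. *)
Definition order_stat (R : realType) (n : nat) (x : nat -> R) (j : nat) : R :=
  nth 0 (sort <=%R (mkseq x n)) j.-1.

Definition ecf_index (R : realType) (n : nat) (p : R) : nat :=
  xget 0%N [set k | (k%:R - 1) / n%:R <= p < k%:R / n%:R].

(* Meaningful when [ecf_index n p < n], i.e. [p < 1 - n%:R^-1]; for a fixed
   [p < 1] this fails for finitely many [n] only. *)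
Definition ecf (R : realType) (n : nat) (x : nat -> R) (p : R) : R :=
  let k := ecf_index n p in
  k%:R^-1 * (\sum_(1 <= j < k.+1) order_stat n x j) - order_stat n x k
  + (n - k)%:R^-1 * (\sum_(k.+1 <= j < n.+1) order_stat n x j)
  - order_stat n x k.+1.

(* Main.v *)
(* Put c = F^-1(p).  For a sample x sorted as s_1 <= ... <= s_n,
   sum_{j <= k} (s_j - c) = - sum_i (c - x_i)^+ up to n |s_k - c|, and
   symmetrically above k, so replacing order statistics near c by c turns G_n(p)
   into a combination of the empirical means of (c - W)^+ and (W - c)^+.  These
   means converge by Chebyshev's weak law of large numbers; the order statistics
   of ranks k and k + 1 converge to c because the empirical distribution
   function does so at c - r and c + r.  Finally, F^-1 of a uniform variable has
   the law of W, hence G(p) = E(W - c)^+ / (1 - p) - E(c - W)^+ / p. *)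
From HB Require Import structures.
Require Import Defs.
From mathcomp Require Import ring lra measurable_realfun.

Set Implicit Arguments.
Unset Strict Implicit.
Unset Printing Implicit Defensive.

Local Open Scope classical_set_scope.
Local Open Scope ring_scope.

(** * Order statistics: counting, monotonicity and partial sums *)

Section order_statistics.
Context (R : realType).
Implicit Types (x : nat -> R) (c : R) (n k j : nat).

(** In the sorted sample the entries at most [c] form an initial segment, and sorting preserves
    their number. This duality turns bounds on order statistics into bounds on the empirical
    distribution function. *)
Lemma order_stat_le n x j c : (0 < j <= n)%N ->
  (order_stat n x j <= c) = (j <= \sum_(i < n) (x i <= c)%R)%N.
Proof.
move=> /andP[j0 jn]; rewrite /order_stat.
set s := sort _ _.
have ss : sorted <=%R s by exact: sort_le_sorted.
have sz : size s = n by rewrite size_sort size_mkseq.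
have cnt : count (<= c) s = (\sum_(i < n) (x i <= c)%R)%N.
  rewrite -sum1_count (perm_big (mkseq x n)) /=; last by rewrite perm_sort.
  rewrite -(big_mkord xpredT (fun i => nat_of_bool (x i <= c))).
  rewrite /mkseq big_map /index_iota subn0 [LHS]big_mkcond.
  by apply: eq_bigr => i _; case: (_ <= _).
rewrite -cnt; apply/idP/idP => [h|h]; last first.
  by apply: nth_count_le => //; rewrite prednK.
rewrite leqNgt; apply/negP => h2.
have := @nth_count_gt _ _ c 0 s j.-1 ss.
rewrite -(prednK j0) in h2; rewrite -ltnS h2/= sz (prednK j0) jn => /(_ isT).
by rewrite ltNge h.
Qed.

Lemma order_stat_homo n x j k : (0 < j)%N -> (j <= k <= n)%N ->
  order_stat n x j <= order_stat n x k.
Proof.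
case: j => // j _; case: k => // k /andP[jk kn].
apply: (sorted_leq_nth le_trans le_refl) => //.
- exact: sort_le_sorted.
- by rewrite inE size_sort size_mkseq (leq_ltn_trans _ kn).
- by rewrite inE size_sort size_mkseq.
Qed.

Lemma sum_order_stat n x (h : R -> R) :
  \sum_(1 <= j < n.+1) h (order_stat n x j) = \sum_(i < n) h (x i).
Proof.
rewrite big_add1/= /order_stat /=.
set s := sort _ _.
have sz : size s = n by rewrite size_sort size_mkseq.
transitivity (\sum_(y <- s) h y).
  by rewrite [RHS](big_nth 0) sz.
rewrite (perm_big (mkseq x n)) /=; last by rewrite perm_sort.
by rewrite -(big_mkord xpredT (h \o x)) /mkseq big_map /index_iota subn0.
Qed.

(* Each of the [n] terms of the combined sum lies between [0] and
   [`|order_stat n x k - c|]; likewise in [upper_sum_order_stat]. *)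
Lemma lower_sum_order_stat n x k c : (0 < k <= n)%N ->
  `|\sum_(1 <= j < k.+1) (order_stat n x j - c)
    + \sum_(i < n) Num.max (c - x i) 0| <= n%:R * `|order_stat n x k - c|.
Proof.
move=> /andP[k0 kn].
rewrite -(sum_order_stat n x (fun y => Num.max (c - y) 0)).
rewrite (@big_cat_nat _ _ _ k.+1 1%N n.+1)//= addrA -big_split/=.
have B1 : \sum_(1 <= j < k.+1) (order_stat n x j - c +
    Num.max (c - order_stat n x j) 0)
    <= \sum_(1 <= j < k.+1) `|order_stat n x k - c|.
  rewrite ler_sum_nat// => j /andP[j1 jk].
  have h : order_stat n x j <= order_stat n x k.
    by apply: order_stat_homo => //; rewrite -ltnS jk.
  by case: (ler0P (order_stat n x k - c)) => ?; case: (leP (c - _) 0) => ?; lra.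
have B2 : \sum_(k.+1 <= j < n.+1) Num.max (c - order_stat n x j) 0
    <= \sum_(k.+1 <= j < n.+1) `|order_stat n x k - c|.
  rewrite ler_sum_nat// => j /andP[j1 jk].
  have h : order_stat n x k <= order_stat n x j.
    by apply: order_stat_homo => //; rewrite (ltnW j1) -ltnS.
  by case: (ler0P (order_stat n x k - c)) => ?; case: (leP (c - _) 0) => ?; lra.
have D1 : 0 <= \sum_(1 <= j < k.+1) (order_stat n x j - c +
    Num.max (c - order_stat n x j) 0).
  by apply: sumr_ge0 => j _; case: (leP (c - _) 0) => ?; lra.
have D2 : 0 <= \sum_(k.+1 <= j < n.+1) Num.max (c - order_stat n x j) 0.
  by apply: sumr_ge0 => j _; rewrite le_max lexx orbT.
rewrite ger0_norm ?addr_ge0//.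
apply: (le_trans (lerD B1 B2)).
rewrite -big_cat_nat//=.
by rewrite sumr_const_nat subn1 /= mulr_natl.
Qed.

Lemma upper_sum_order_stat n x k c : (k < n)%N ->
  `|\sum_(k.+1 <= j < n.+1) (order_stat n x j - c)
    - \sum_(i < n) Num.max (x i - c) 0| <= n%:R * `|order_stat n x k.+1 - c|.
Proof.
move=> kn; have kn' := ltnW kn.
rewrite -(sum_order_stat n x (fun y => Num.max (y - c) 0)).
rewrite (@big_cat_nat _ _ _ k.+1 1%N n.+1)//= distrC -addrA -sumrB.
have B1 : \sum_(1 <= j < k.+1) Num.max (order_stat n x j - c) 0
    <= \sum_(1 <= j < k.+1) `|order_stat n x k.+1 - c|.
  rewrite ler_sum_nat// => j /andP[j1 jk].
  have h : order_stat n x j <= order_stat n x k.+1.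
    by apply: order_stat_homo => //; rewrite kn ltnW.
  by case: (ler0P (order_stat n x k.+1 - c)) => ?; case: (leP (_ - c) 0) => ?; lra.
have B2 : \sum_(k.+1 <= j < n.+1) (Num.max (order_stat n x j - c) 0 -
    (order_stat n x j - c))
    <= \sum_(k.+1 <= j < n.+1) `|order_stat n x k.+1 - c|.
  rewrite ler_sum_nat// => j /andP[j1 jk].
  have h : order_stat n x k.+1 <= order_stat n x j.
    by apply: order_stat_homo => //; rewrite j1 -ltnS.
  by case: (ler0P (order_stat n x k.+1 - c)) => ?; case: (leP (_ - c) 0) => ?; lra.
have D1 : 0 <= \sum_(1 <= j < k.+1) Num.max (order_stat n x j - c) 0.
  by apply: sumr_ge0 => j _; rewrite le_max lexx orbT.
have D2 : 0 <= \sum_(k.+1 <= j < n.+1) (Num.max (order_stat n x j - c) 0 -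
    (order_stat n x j - c)).
  by apply: sumr_ge0 => j _; case: (leP (_ - c) 0) => ?; lra.
rewrite ger0_norm ?addr_ge0//.
apply: (le_trans (lerD B1 B2)).
rewrite -big_cat_nat//=.
by rewrite sumr_const_nat subn1 /= mulr_natl.
Qed.
End order_statistics.

(** * The rank [k] and a deterministic approximation of the ECF by empirical means *)

Section ecf_deterministic.
Context (R : realType).
Implicit Types (x : nat -> R) (p c : R) (n k : nat).

Lemma ecf_indexP n p : (0 < n)%N -> 0 <= p ->
  ((ecf_index n p)%:R - 1) / n%:R <= p < (ecf_index n p)%:R / n%:R.
Proof.
move=> n0 p0; have n0' : 0 < n%:R :> R by rewrite ltr0n.
(* The integer part of [p * n] plus one satisfies both inequalities, which excludes the default
   value of [xget]. *)
rewrite /ecf_index; case: xgetP => [k _ //|/(_ (Num.truncn (p * n%:R)).+1)].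
have /truncn_itv/andP[h1 h2] : 0 <= p * n%:R by rewrite mulr_ge0// ltW.
by case; rewrite /= ler_pdivrMr// ltr_pdivlMr// h2 -natr1 addrK h1.
Qed.

Lemma ecf_index_gt0 n p : (0 < n)%N -> 0 <= p -> (0 < ecf_index n p)%N.
Proof.
move=> n0 p0; have /andP[_] := ecf_indexP n0 p0.
by case: ecf_index => //; rewrite mul0r ltNge p0.
Qed.

Lemma ecf_index_bounds n p : (0 < n)%N -> 0 <= p ->
  p * n%:R < (ecf_index n p)%:R <= p * n%:R + 1.
Proof.
move=> n0 p0; have n0' : 0 < n%:R :> R by rewrite ltr0n.
have := ecf_indexP n0 p0.
by rewrite ler_pdivrMr// ltr_pdivlMr// lerBlDr andbC.
Qed.

(** Divide the estimates of the lower and upper sums by [k] and [n - k]; this gives the factors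
    [n / k] and [n / (n - k)]. The summands 1 pay for replacing the two subtracted order statistics
    by [c]. *)
Lemma ecf_dist n x p c (k := ecf_index n p) : (0 < k < n)%N ->
  `|ecf n x p
    - (n%:R / (n - k)%:R * (n%:R^-1 * \sum_(i < n) Num.max (x i - c) 0)
       - n%:R / k%:R * (n%:R^-1 * \sum_(i < n) Num.max (c - x i) 0))|
  <= (1 + n%:R / k%:R) * `|order_stat n x k - c|
     + (1 + n%:R / (n - k)%:R) * `|order_stat n x k.+1 - c|.
Proof.
move=> /andP[k0 kn].
have n0' : 0 < n%:R :> R by rewrite ltr0n (ltn_trans k0).
have k0' : 0 < k%:R :> R by rewrite ltr0n.
have nk0' : 0 < (n - k)%:R :> R by rewrite ltr0n subn_gt0.
have kn' : (0 < k <= n)%N by rewrite k0 ltnW.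
have := @lower_sum_order_stat _ n x k c kn'.
have := @upper_sum_order_stat _ n x k c kn.
rewrite /ecf -/k; move: (order_stat n x k) (order_stat n x k.+1) => s s'.
rewrite !sumrB !sumr_const_nat subSS subSS subn0.
rewrite -(mulr_natr c (n - k)) -(mulr_natr c k).
set SL := \sum_(1 <= _ < _) _; set SU := \sum_(k.+1 <= _ < _) _.
set U := \sum_(i < n) _; set L := \sum_(i < n) _ => hU hL.
have := ler_wpM2l (ltW (divr_gt0 ltr01 k0')) hL.
have := ler_wpM2l (ltW (divr_gt0 ltr01 nk0')) hU.
rewrite !div1r -{1}(gtr0_norm nk0') -{1}(gtr0_norm k0').
rewrite -!normrV ?unitfE ?gt_eqF//.
rewrite -!normrM => hU' hL'.
set E := _ - (_ - _).
(* Each centred average contributes [- c], and the last two differences contribute [2 * c], so [c]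
   cancels. *)
have -> : E = (n - k)%:R^-1 * (SU - c * (n - k)%:R - U)
  + k%:R^-1 * (SL - c * k%:R + L) + (c - s) + (c - s').
  rewrite /E; move: n0' k0' nk0'; clear.
  move: SL SU U L (n - k)%:R k%:R n%:R => SL SU L U m k' n' n0 k0 m0.
  by field; rewrite ?gt_eqF.
apply: (le_trans (ler_normD _ _)).
rewrite (distrC c s') (le_trans (lerD (ler_normD _ _) (lexx _)))//.
rewrite (distrC c s).
rewrite (le_trans (lerD (lerD (ler_normD _ _) (lexx _)) (lexx _)))//.
rewrite !(mulrDl 1) !mul1r -!(mulrA n%:R) !(mulrCA n%:R).
lra.
Qed.

Lemma cvg_ecf_index p : 0 <= p -> (ecf_index n p)%:R / n%:R @[n --> \oo] --> p.
Proof.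
move=> p0.
have h0 : (n%:R^-1 : R) @[n --> \oo] --> 0.
  by rewrite -cvg_shiftS; exact: cvg_harmonic.
apply: (@squeeze_cvgr _ _ _ _ (cst p) (fun n => p + n%:R^-1)).
- near=> n; have n0 : (0 < n)%N by near: n; exists 1%N.
  have n0' : 0 < n%:R :> R by rewrite ltr0n.
  have /andP[h1 h2] := ecf_index_bounds n0 p0.
  rewrite ler_pdivlMr// ltW//= ler_pdivrMr// mulrDl mulVf ?gt_eqF//.
- exact: cvg_cst.
- by rewrite -[X in _ --> X]addr0; apply: cvgD => //; exact: cvg_cst.
Unshelve. all: by end_near. Qed.

End ecf_deterministic.

(** * Large sample size: error bounds uniform in the sample *)

Section ecf_limits.
Context (R : realType).
Implicit Types (x : nat -> R) (p c a b : R) (n k : nat).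

Lemma ecf_index_lt_near p : 0 < p < 1 ->
  \forall n \near \oo, (0 < ecf_index n p < n)%N.
Proof.
move=> /andP[p0 p1].
have h : \forall n \near \oo, (ecf_index n p)%:R / n%:R < 1 :> R.
  by apply: cvgr_lt p1; exact: cvg_ecf_index (ltW p0).
near=> n; have n0 : (0 < n)%N by near: n; exists 1%N.
rewrite ecf_index_gt0 ?(ltW p0)//= -(ltr_nat R).
have : (ecf_index n p)%:R / n%:R < 1 :> R by near: n; exact: h.
by rewrite ltr_pdivrMr ?ltr0n// mul1r.
Unshelve. all: by end_near. Qed.

(** The tolerance [r] and the threshold on [n] are chosen before [x] and [c]. The bound can
    therefore be applied outcome by outcome to a random sample. *)
Lemma ecf_near p a b (e : R) : 0 < p < 1 -> 0 < e ->
  exists2 r : R, 0 < r & \forall n \near \oo, forall x c,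
    `|n%:R^-1 * (\sum_(i < n) Num.max (c - x i) 0) - a| < r ->
    `|n%:R^-1 * (\sum_(i < n) Num.max (x i - c) 0) - b| < r ->
    `|order_stat n x (ecf_index n p) - c| <= r ->
    `|order_stat n x (ecf_index n p).+1 - c| <= r ->
    `|ecf n x p - (b / (1 - p) - a / p)| < e.
Proof.
move=> p01 e0; have /andP[p0 p1] := p01.
have p'0 : 0 < 1 - p by rewrite subr_gt0.
(* [C] bounds [1 + n / k] and [1 + n / (n - k)] as soon as these ratios are within [s <= 1] of their
   limits. The second argument of the minimum [s] keeps the error from replacing the ratios by their
   limits below [e / 2]. *)
pose C := 2 + p^-1 + (1 - p)^-1.
have C0 : 0 < C by rewrite !addr_gt0 ?invr_gt0.
pose s := Num.min 1 (e / (2 * (`|a| + `|b| + 1))).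
have D0 : 0 < `|a| + `|b| + 1 by rewrite ltr_wpDl// addr_ge0.
have s0 : 0 < s by rewrite lt_min ltr01 divr_gt0// mulr_gt0.
exists (e / (8 * C)); first by rewrite divr_gt0// mulr_gt0.
have ck := cvg_ecf_index (ltW p0).
have cu : n%:R / (ecf_index n p)%:R @[n --> \oo] --> p^-1.
  under eq_fun do rewrite -invf_div.
  by apply: cvgV => //; rewrite gt_eqF.
have cv : n%:R / (n - ecf_index n p)%:R @[n --> \oo] --> (1 - p)^-1.
  have : (1 - (ecf_index n p)%:R / n%:R)^-1 @[n --> \oo] --> (1 - p)^-1.
    apply: cvgV; first by rewrite gt_eqF.
    by apply: cvgB => //; exact: cvg_cst.
  (* The subtraction [n - k] is truncated, so the two expressions are identified only for [n] so
     large that [k < n]. *)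
  apply: cvg_trans; apply: near_eq_cvg; near=> n.
  have /andP[k0 kn] : (0 < ecf_index n p < n)%N.
    by near: n; exact: ecf_index_lt_near.
  rewrite -[in RHS]invf_div natrB ?(ltnW kn)// mulrBl divff// pnatr_eq0.
  by rewrite -lt0n (ltn_trans k0).
near=> n => x c.
have kn : (0 < ecf_index n p < n)%N by near: n; exact: ecf_index_lt_near.
have hu : `|p^-1 - n%:R / (ecf_index n p)%:R| < s.
  by near: n; move/cvgrPdist_lt: cu; apply.
have hv : `|(1 - p)^-1 - n%:R / (n - ecf_index n p)%:R| < s.
  by near: n; move/cvgrPdist_lt: cv; apply.
have := ecf_dist x c kn.
set k := ecf_index n p in hu hv *.
have u0 : 0 <= n%:R / k%:R :> R by rewrite divr_ge0.
have v0 : 0 <= n%:R / (n - k)%:R :> R by rewrite divr_ge0.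
move: (n%:R / k%:R) (n%:R / (n - k)%:R) hu hv u0 v0 => u v hu hv u0 v0.
set B := n%:R^-1 * _; set A := n%:R^-1 * _.
move: (order_stat n x k) (order_stat n x k.+1) => y z H hA hB hy hz.
set r := e / (8 * C) in hA hB hy hz.
have r0 : 0 < r by rewrite divr_gt0// mulr_gt0.
have s1 : s <= 1 by rewrite ge_min lexx.
have al0 : 0 < p^-1 by rewrite invr_gt0.
have be0 : 0 < (1 - p)^-1 by rewrite invr_gt0.
have uC : 1 + u <= C.
  by move: hu; rewrite ltr_norml /C => /andP[]; lra.
have vC : 1 + v <= C.
  by move: hv; rewrite ltr_norml /C => /andP[]; lra.
have rC : C * r = e / 8 by rewrite /r; field; rewrite gt_eqF.
have ab : (`|a| + `|b|) * s < e / 2.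
  have : (`|a| + `|b| + 1) * s <= e / 2.
    rewrite -ler_pdivlMl// /s ge_min; apply/orP; right.
    by rewrite invfM mulrA mulrC.
  by rewrite mulrDl mul1r; lra.
have E1 : (1 + u) * `|y - c| <= e / 8.
  by rewrite -rC ler_pM// addr_ge0.
have E2 : (1 + v) * `|z - c| <= e / 8.
  by rewrite -rC ler_pM// addr_ge0.
have E3 : `|u * (A - a)| <= e / 8.
  rewrite normrM (ger0_norm u0) -rC ler_pM//; last exact: ltW.
  by rewrite (le_trans _ uC)// lerDr.
have E4 : `|v * (B - b)| <= e / 8.
  rewrite normrM (ger0_norm v0) -rC ler_pM//; last exact: ltW.
  by rewrite (le_trans _ vC)// lerDr.
have E5 : `|b * (v - (1 - p)^-1)| + `|a * (u - p^-1)| < e / 2.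
  apply: le_lt_trans ab; rewrite !normrM mulrDl [leRHS]addrC.
  by rewrite lerD// ler_wpM2l// distrC ltW.
(* The error splits into the two order-statistic terms and the two errors of the means, each at most
   [e / 8], and the error of the ratios, which is less than [e / 2]. *)
have -> : ecf n x p - (b / (1 - p) - a / p) = ecf n x p - (v * B - u * A)
    + (v * (B - b) - u * (A - a) + (b * (v - (1 - p)^-1) - a * (u - p^-1))).
  by ring.
apply: le_lt_trans (ler_normD _ _) _.
apply: le_lt_trans (lerD H (ler_normD _ _)) _.
apply: le_lt_trans (lerD (lexx _) (lerD (ler_normB _ _) (ler_normB _ _))) _.
lra.
Unshelve. all: by end_near. Qed.

(** Counting gives both sides. At most [p * n < k] sample points lie at or below [c - r], so rank
    [k] lies above it. At least [(p + s) * n] lie at or below [c + r], and this reaches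
    [k + 1 <= p * n + 2] once [n >= 2 / s]. Hence slack [s] appears on the upper side only. *)
Lemma order_stat_near p (r s : R) : 0 < p < 1 -> 0 < s ->
  \forall n \near \oo, forall x c,
    p + s <= n%:R^-1 * \sum_(i < n) (x i <= c + r)%R%:R ->
    n%:R^-1 * \sum_(i < n) (x i <= c - r)%R%:R <= p ->
    `|order_stat n x (ecf_index n p) - c| <= r /\
    `|order_stat n x (ecf_index n p).+1 - c| <= r.
Proof.
move=> p01 s0; have /andP[p0 p1] := p01.
have ns : \forall n \near \oo, 2 / s <= n%:R by exact: nbhs_infty_ger.
near=> n => x c.
have /andP[k0 kn] : (0 < ecf_index n p < n)%N.
  by near: n; exact: ecf_index_lt_near.
have n0 : (0 < n)%N by exact: ltn_trans kn.
have n0' : 0 < n%:R :> R by rewrite ltr0n.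
have /andP[k1 k2] := ecf_index_bounds n0 (ltW p0).
have ns' : 2 <= s * n%:R by rewrite mulrC -ler_pdivrMr//; near: n; exact: ns.
rewrite ![n%:R^-1 * _]mulrC ler_pdivlMr// ler_pdivrMr// -!natr_sum => h1 h2.
set k := ecf_index n p in k0 kn k1 k2 *.
have up : order_stat n x k.+1 <= c + r.
  by rewrite order_stat_le// -(ler_nat R) -natr1; lra.
have dn : c - r < order_stat n x k.
  rewrite ltNge order_stat_le ?k0 ?(ltnW kn)// -ltnNge -(ltr_nat R); lra.
have hm : order_stat n x k <= order_stat n x k.+1.
  by apply: order_stat_homo => //; rewrite leqnSn.
by rewrite !ler_norml; split; apply/andP; split; lra.
Unshelve. all: by end_near. Qed.

End ecf_limits.

(** * Laws of real random variables: determination by the cdf, and independence *)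

Section law_of_a_real_random_variable.
Context (R : realType).

(** The rays []x, +oo[] are stable under intersection, generate the Borel sets and exhaust the line.
    Their probabilities are the complements of the values of the cdf. *)
Lemma eq_cdf_distribution d1 (T1 : measurableType d1)
    d2 (T2 : measurableType d2) (P1 : probability T1 R) (P2 : probability T2 R)
    (X : {RV P1 >-> R}) (Y : {RV P2 >-> R}) :
  cdf X =1 cdf Y ->
  forall A, measurable A -> distribution P1 X A = distribution P2 Y A.
Proof.
move=> XY A mA.
apply: (measure_unique (@RGenOInfty.G R) (fun n => `]-(n%:R), +oo[%classic)) => //.
- exact: RGenOInfty.measurableE.
- move=> _ _ [x ->] [y ->]; exists (Num.max x y).
  apply/seteqP; split=> z /=; rewrite !in_itv/= !andbT gt_max.
    by move=> [-> ->].
  by move=> /andP[].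
- by move=> n; exists (- n%:R).
- apply/seteqP; split=> // z _; exists (Num.truncn `|z|).+1 => //=.
  rewrite in_itv/= andbT ltrNl.
  have /truncn_itv/andP[_ h] := normr_ge0 z.
  by rewrite (le_lt_trans _ h)// -normrN ler_norm.
- move=> _ [x ->]; rewrite -setCitvl.
  apply: etrans (probability_setC (distribution P1 X) (measurable_itv _)) _.
  apply: etrans (esym (probability_setC (distribution P2 Y) (measurable_itv _))).
  by congr (1 - _)%E; exact: XY.
- by move=> n; rewrite -ge0_fin_numE// fin_num_measure.
Qed.

Lemma eq_distribution_integral d1 (T1 : measurableType d1)
    d2 (T2 : measurableType d2) (P1 : probability T1 R) (P2 : probability T2 R)
    (X : {RV P1 >-> R}) (Y : {RV P2 >-> R}) (g : R -> \bar R) :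
  cdf X =1 cdf Y -> measurable_fun setT g -> (forall x, (0 <= g x)%E) ->
  (\int[P1]_t g (X t) = \int[P2]_t g (Y t))%E.
Proof.
move=> XY mg g0.
rewrite -(ge0_integral_distribution X mg g0) -(ge0_integral_distribution Y mg g0).
by apply: eq_measure_integral => A mA _; exact: eq_cdf_distribution.
Qed.

(** By independence the law of the pair agrees with the product of the two laws on rectangles, hence
    everywhere. Tonelli's theorem for the nonnegative product then separates the factors. *)
Lemma independent_expectationM d (T : measurableType d) (P : probability T R)
    (X Y : {RV P >-> R}) (g h : R -> R) :
  (forall A B : set R, measurable A -> measurable B ->
    (P (X @^-1` A `&` Y @^-1` B) = P (X @^-1` A) * P (Y @^-1` B))%E) ->
  measurable_fun setT g -> measurable_fun setT h ->
  (forall x, 0 <= g x) -> (forall x, 0 <= h x) ->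
  ('E_P[(g \o X) * (h \o Y)] = 'E_P[g \o X] * 'E_P[h \o Y])%E.
Proof.
move=> XY mg mh g0 h0.
pose Z t := (X t, Y t).
have mZ : measurable_fun setT Z by exact/measurable_fun_pair.
pose ZR : {RV P >-> (R * R)%type} := HB.pack Z (isMeasurableFun.Build _ _ _ _ _ mZ).
have mEg : measurable_fun setT (EFin \o g) by exact/measurable_EFinP.
have mEh : measurable_fun setT (EFin \o h) by exact/measurable_EFinP.
have DXY A : measurable A ->
    (distribution P X \x distribution P Y)%E A = distribution P ZR A.
  by apply: product_measure_unique => A1 A2 mA1 mA2; exact: XY.
pose f (z : R * R) : \bar R := (g z.1 * h z.2)%:E.
have mf : measurable_fun setT f.
  apply/measurable_EFinP; apply: measurable_funM.
    exact: measurableT_comp mg measurable_fst.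
  exact: measurableT_comp mh measurable_snd.
have f0 z : (0 <= f z)%E by rewrite lee_fin mulr_ge0.
rewrite unlock.
transitivity (\int[distribution P ZR]_z f z)%E.
  by rewrite ge0_integral_distribution.
transitivity (\int[distribution P X \x distribution P Y]_z f z)%E.
  by apply: eq_measure_integral => A mA _; apply/esym/DXY.
rewrite fubini_tonelli1// /fubini_F.
under eq_integral.
  move=> x _; rewrite /f/=.
  under eq_integral do rewrite EFinM.
  rewrite ge0_integralZl//=; last 2 first.
  - by move=> y _; rewrite lee_fin.
  - by rewrite lee_fin.
  rewrite (ge0_integral_distribution Y mEh)/=; last by move=> y; rewrite lee_fin.
  over.
rewrite /= ge0_integralZr//=; last 2 first.
- by move=> y _; rewrite lee_fin.
- by apply: integral_ge0 => t _; rewrite lee_fin.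
by rewrite (ge0_integral_distribution X mEg)//= => y; rewrite lee_fin.
Qed.

End law_of_a_real_random_variable.

(** * Chebyshev's weak law of large numbers *)

Section weak_law_of_large_numbers.
Context d (T : measurableType d) (R : realType) (P : probability T R).

Lemma Lfun2_sqr_lty (X : T -> R) : measurable_fun setT X ->
  ('E_P[(fun t => X t ^+ 2)%R] < +oo)%E -> X \in Lfun P 2%:E.
Proof.
move=> mX; rewrite unlock => X2.
rewrite inE; apply/andP; split; first by rewrite inE.
rewrite inE/= /finite_norm unlock /Lnorm poweR_lty//.
apply: le_lt_trans X2.
rewrite le_eqVlt; apply/orP; left; apply/eqP/eq_integral => t _ /=.
by rewrite powR_mulrn// real_normK// num_real.
Qed.

Lemma uncorrelated_weak_law (Y : nat -> T -> R) (m v : R) :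
  (forall i, Y i \in Lfun P 2%:E) ->
  (forall i, 'E_P[Y i] = m%:E)%E -> (forall i, 'V_P[Y i] = v%:E)%E ->
  (forall i j, (i < j)%N -> covariance P (Y i) (Y j) = 0%E) ->
  cvg_in_probability P (fun n t => n%:R^-1 * \sum_(i < n) Y i t) (fun=> m).
Proof.
move=> Y2 Ym Yv Yc.
have Pfin : P setT \is a fin_num := fin_num_measure P _ measurableT.
pose S n := fun t => \sum_(i < n) Y i t.
have SS n : S n.+1 = S n \+ Y n by apply/funext => t; rewrite /S big_ord_recr.
have S0 : S 0%N = cst 0 by apply/funext => t; rewrite /S big_ord0.
have S2 n : S n \in Lfun P 2%:E.
  elim: n => [|n IHn]; first by rewrite S0 Lfun_cst.
  by rewrite SS rpredD//= lee1n.
have Sm n : ('E_P[S n] = (n%:R * m)%:E)%E.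
  elim: n => [|n IHn]; first by rewrite S0 expectation_cst mul0r.
  by rewrite SS expectationD ?Lfun_subset12// IHn Ym -natr1 mulrDl mul1r.
(* A partial sum is uncorrelated with every later term, so variances add up in the next
   induction. *)
have Sc n k : (n <= k)%N -> covariance P (S n) (Y k) = 0%E.
  elim: n => [|n IHn] nk; first by rewrite S0 covariance_cst_l.
  by rewrite SS covarianceDl// IHn ?(ltnW nk)// Yc// adde0.
have Sv n : ('V_P[S n] = (n%:R * v)%:E)%E.
  elim: n => [|n IHn]; first by rewrite S0 variance_cst mul0r.
  by rewrite SS varianceD// IHn Yv Sc// mule0 adde0 -natr1 mulrDl mul1r.
move=> e e0.
have h0 : (n%:R^-1 : R) @[n --> \oo] --> 0.
  by rewrite -cvg_shiftS; exact: cvg_harmonic.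
have hb : ((e ^- 2 * v) * n%:R^-1)%:E @[n --> \oo] --> 0%E.
  apply: cvg_EFin; first exact: nearW.
  rewrite -[X in _ --> X](mulr0 (e ^- 2 * v)).
  by apply: cvgM => //; exact: cvg_cst.
apply: (squeeze_cvge _ (cvg_cst 0%E) hb).
near=> n; rewrite measure_ge0/=.
have n0 : n%:R != 0 :> R by rewrite pnatr_eq0 -lt0n; near: n; exists 1%N.
have M2 : (n%:R^-1 \o* S n) \in Lfun P 2%:E by rewrite Lfun_scale// ler1n.
have mM : measurable_fun setT (n%:R^-1 \o* S n).
  by move: M2; rewrite inE => /andP[]; rewrite inE.
pose M : {RV P >-> R} := HB.pack (n%:R^-1 \o* S n) (isMeasurableFun.Build _ _ _ _ _ mM).
have := @chebyshev _ _ _ P M _ e0.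
rewrite /M/= expectationZl ?Lfun_subset12// Sm varianceZ// Sv -!EFinM/=.
rewrite mulKf//.
(* The variance of the mean is [v / n], so Chebyshev's bound is of order [1 / n]. *)
have -> : e ^- 2 * (n%:R^-1 ^+ 2 * (n%:R * v)) = e ^- 2 * v / n%:R.
  by field; rewrite n0 gt_eqF.
by under eq_set do rewrite mulrC.
Unshelve. all: by end_near. Qed.

(** The common cdf gives all [g (W i)] the first two moments of [g (W 0)], and independence makes
    them uncorrelated. The general [g] serves positive parts and indicators alike. *)
Lemma iid_weak_law (W : nat -> {RV P >-> R}) (F : R -> R) (g : R -> R) :
  mutually_independent W -> (forall i x, cdf (W i) x = (F x)%:E) ->
  measurable_fun setT g -> (forall x, 0 <= g x) ->
  ('E_P[(fun t => g (W 0%N t) ^+ 2)%R] < +oo)%E ->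
  cvg_in_probability P (fun n t => n%:R^-1 * \sum_(i < n) g (W i t))
    (fun=> fine 'E_P[g \o W 0%N]%E).
Proof.
move=> Wi WF mg g0 g2.
have Pfin : P setT \is a fin_num := fin_num_measure P _ measurableT.
have WW i : cdf (W i) =1 cdf (W 0%N) by move=> x; rewrite !WF.
have mY i : measurable_fun setT (g \o W i) by exact: measurableT_comp.
have EY i : ('E_P[g \o W i] = 'E_P[g \o W 0%N])%E.
  rewrite unlock; apply: (eq_distribution_integral (g := EFin \o g)) => //.
  exact/measurable_EFinP.
have E2 i : ('E_P[(g \o W i) ^+ 2] = 'E_P[(g \o W 0%N) ^+ 2])%E.
  rewrite unlock; apply: (eq_distribution_integral (g := fun x => (g x ^+ 2)%:E)) => //.
    by apply/measurable_EFinP; exact: measurable_funX.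
  by move=> x; rewrite /= lee_fin sqr_ge0.
have Y2 i : g \o W i \in Lfun P 2%:E.
  by apply: Lfun2_sqr_lty => //; have := E2 i; rewrite /= => ->.
have EYf i : ('E_P[g \o W i] = (fine 'E_P[g \o W 0%N]%E)%:E)%E.
  by rewrite EY fineK// expectation_fin_num// Lfun_subset12.
apply: (@uncorrelated_weak_law (fun i => g \o W i) _ (fine 'V_P[g \o W 0%N]%E)) => //.
- move=> i; rewrite fineK ?variance_fin_num//.
  by rewrite !varianceE// E2 EY.
- move=> i j ij.
  rewrite covarianceE ?Lfun2_mul_Lfun1 ?Lfun_subset12//.
  rewrite independent_expectationM// ?subee//.
    by rewrite fin_numM// EYf.
  move=> A B mA mB.
  (* Pairwise independence is mutual independence on a two-element index set. *)
  have := Wi [fset i; j]%fset (fun k => if k == i then A else B).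
  have ji : (j == i) = false by rewrite gtn_eqF.
  have iNj : i \notin [fset j]%fset by rewrite inE eq_sym ji.
  rewrite big_fsetU1//= big_seq_fset1 eqxx ji => <-; last first.
    by move=> k; case: ifP.
  congr (P _); apply/seteqP; split=> t /=.
    move=> [At Bt] k /=; rewrite !inE => /orP[] /eqP ->; rewrite ?eqxx ?ji//.
  move=> h; split.
    by have := h i; rewrite /= !inE eqxx /=; apply.
  by have := h j; rewrite /= !inE eqxx orbT ji /=; apply.
Qed.

End weak_law_of_large_numbers.

(** * Measurability of order statistics and of the ECF *)

Section measurability.
Context d (T : measurableType d) (R : realType).

(** Open upper rays generate the Borel sets, and their preimages are complements in [D] of sublevel
    sets. The criterion suits order statistics and [F^-1], whose sublevel sets are explicit. *)
Lemma measurable_fun_lower_sets (D : set T) (h : T -> R) : measurable D ->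
  (forall x, measurable (D `&` [set t | h t <= x])) -> measurable_fun D h.
Proof.
move=> mD mh.
apply: (measurability (@RGenOInfty.G R)) => [|/= _ [_] [r] -> <-].
  exact: RGenOInfty.measurableE.
rewrite (_ : _ `&` _ = D `\` (D `&` [set t | h t <= r])).
  exact: measurableD.
apply/seteqP; split=> t /=; rewrite in_itv/= andbT ltNge.
  by move=> [Dt /negP ht]; split=> // -[].
by move=> [Dt ht]; split=> //; apply/negP => hr; exact: ht.
Qed.

Lemma le_indicE (c x : R) : (x <= c)%R%:R = \1_(`]-oo, c]%classic) x :> R.
Proof.
rewrite indicE; congr (_%:R); congr nat_of_bool.
by apply/idP/idP; rewrite ?inE ?in_setE/= ?in_itv.
Qed.

Lemma measurable_order_stat n (W : nat -> T -> R) j :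
  (forall i, measurable_fun setT (W i)) ->
  measurable_fun setT (fun t => order_stat n (fun i => W i t) j).
Proof.
(* Rank 0 reads the same entry as rank 1, because of the predecessor [j.-1]. *)
move=> mW; wlog j0 : j / (0 < j)%N.
  by case: j => [/(_ 1%N isT)//|j]; exact.
(* Beyond rank [n], [nth] returns its default, a constant. *)
have [jn|nj] := leqP j n; last first.
  rewrite (_ : (fun t => _) = cst 0) //; apply/funext => t /=.
  rewrite /order_stat nth_default// size_sort size_mkseq.
  by rewrite -ltnS prednK.
apply: measurable_fun_lower_sets => // x.
under eq_set do rewrite order_stat_le ?j0// -(ler_nat R) natr_sum.
apply: measurable_fun_le => //; apply: measurable_sum => i.
under eq_fun do rewrite le_indicE.
exact: measurableT_comp.
Qed.

Lemma measurable_ecf n (W : nat -> T -> R) p :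
  (forall i, measurable_fun setT (W i)) ->
  measurable_fun setT (fun t => ecf n (fun i => W i t) p).
Proof.
move=> mW; have mo := measurable_order_stat n _ mW.
do ![apply: measurable_funD]; rewrite ?measurable_funN//.
all: try by apply: measurable_funM => //; exact: measurable_sum.
all: try exact: measurable_funN.
Qed.

End measurability.

(** * The inverse [F^-1] and the quantile transform *)

Section quantile_transform.
Context (R : realType) (F : R -> R).
Hypothesis F_inv : invertible01 F.
Local Notation mu := lebesgue_measure.

Lemma cdf_invK q : 0 < q < 1 -> F (cdf_inv F q) = q.
Proof.
move=> /F_inv[w [Fw _]]; rewrite /cdf_inv.
by case: xgetP => [y _ //|/(_ w)]; exact.
Qed.

Lemma cdf_inv_uniq q w : 0 < q < 1 -> F w = q -> w = cdf_inv F q.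
Proof.
move=> q01 Fw; have [v [_ uv]] := F_inv q01.
by rewrite -(uv _ Fw) -(uv _ (cdf_invK q01)).
Qed.

Hypothesis F_nd : {homo F : x y / x <= y}.

(** If [x < F^-1 q] and [q <= F x], monotonicity forces [F x = q], against uniqueness of the
    solution. *)
Lemma cdf_inv_le q x : 0 < q < 1 -> (cdf_inv F q <= x) = (q <= F x).
Proof.
move=> q01; apply/idP/idP => [|qF].
  by move/F_nd; rewrite cdf_invK.
rewrite leNgt; apply/negP => xq.
have Fx : F x = q.
  by apply/le_anti; rewrite qF andbT -[leRHS](cdf_invK q01) F_nd// ltW.
by rewrite -(cdf_inv_uniq q01 Fx) ltxx in xq.
Qed.

Lemma cdf_inv_homo q r : 0 < q < 1 -> 0 < r < 1 -> q <= r ->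
  cdf_inv F q <= cdf_inv F r.
Proof. by move=> q01 r01 qr; rewrite cdf_inv_le// cdf_invK. Qed.

Lemma cdf_lt_below p c : 0 < p < 1 -> c < cdf_inv F p -> F c < p.
Proof. by move=> p01; rewrite ltNge cdf_inv_le// -ltNge. Qed.

(** Strictness comes from uniqueness: [F] has no flat piece at level [p]. This gap is what lets
    order statistics concentrate at [F^-1 p]. *)
Lemma cdf_gt_above p c : 0 < p < 1 -> cdf_inv F p < c -> p < F c.
Proof.
move=> p01 pc; rewrite lt_neqAle -cdf_inv_le// (ltW pc) andbT.
by apply/eqP => /esym /(cdf_inv_uniq p01) cE; rewrite cE ltxx in pc.
Qed.

Lemma measurable_cdf_inv : measurable_fun (`]0, 1[ : set R) (cdf_inv F).
Proof.
apply: measurable_fun_lower_sets => // x.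
rewrite (_ : _ `&` _ = `]0, 1[ `&` `]-oo, F x]).
  exact: measurableI.
apply/seteqP; split=> q /=; rewrite !in_itv/= => -[q01].
  by rewrite cdf_inv_le.
by move=> qF; split=> //; rewrite cdf_inv_le.
Qed.

Lemma integral_uniform01 (g : R -> \bar R) : measurable_fun setT g ->
  (forall x, (0 <= g x)%E) ->
  (\int[uniform_prob (@ltr01 R)]_x g x = \int[mu]_(x in `]0%R, 1%R[) g x)%E.
Proof.
move=> mg g0; rewrite integral_uniform// subr0 invr1 mul1e.
have mgD (D : set R) : measurable_fun D g by exact: measurable_funTS.
by rewrite -integral_itv_bndo_bndc// -integral_itv_obnd_cbnd.
Qed.

(** For uniform [q], [F^-1 q <= x] exactly when [q <= F x], an event of probability [F x]. So
    [F^-1 q] has the cdf, hence the law, of [X]. *)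
Lemma integral_cdf_inv d (T : measurableType d) (P : probability T R)
    (X : {RV P >-> R}) (g : R -> \bar R) :
  (forall x, cdf X x = (F x)%:E) ->
  measurable_fun setT g -> (forall x, (0 <= g x)%E) ->
  (\int[P]_t g (X t) = \int[mu]_(q in `]0%R, 1%R[) g (cdf_inv F q))%E.
Proof.
move=> XF mg g0.
have F01 x : 0 <= F x <= 1 by rewrite -!lee_fin -(XF x) cdf_ge0 cdf_le1.
(* Extension by 0 makes [F^-1] a random variable on the whole line; only its values on []0, 1[]
   enter the integrals. *)
pose H : measurableTypeR R -> R := cdf_inv F \_ (`]0, 1[ : set R).
have mH : measurable_fun setT H.
  by move/measurable_restrictT: measurable_cdf_inv; apply.
pose HX : {RV (uniform_prob (@ltr01 R)) >-> R} :=
  HB.pack H (isMeasurableFun.Build _ _ _ _ _ mH).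
have HE q : 0 < q < 1 -> H q = cdf_inv F q.
  by move=> q01; rewrite /H patchE mem_set// /= in_itv.
have cdfH : cdf X =1 cdf HX.
  move=> x; rewrite XF; apply/esym.
  transitivity (\int[uniform_prob (@ltr01 R)]_q (\1_(`]-oo, x]) (H q))%:E)%E.
    have mHx : measurable (H @^-1` `]-oo, x]).
      by rewrite -[X in measurable X]setTI; exact: (mH measurableT _ (measurable_itv _)).
    apply: etrans (esym (integral_indic (uniform_prob (@ltr01 R)) measurableT mHx)).
    by rewrite setIT.
  rewrite integral_uniform01; last 2 first.
  - by apply/measurable_EFinP; exact: measurableT_comp.
  - by move=> q; rewrite lee_fin.
  transitivity (\int[mu]_(q in `]0%R, 1%R[) (\1_(`]-oo, F x]) q)%:E)%E.
    apply: eq_integral => q /set_mem/=; rewrite in_itv/= => q01.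
    by rewrite -!le_indicE HE// cdf_inv_le.
  rewrite integral_indic//=.
  have /andP[Fx0 Fx1] := F01 x.
  (* When [F x = 1] the intersection is []0, 1[], open on the right; otherwise it is []0, F x]]. *)
  have [->|Fx] := eqVneq (F x) 1.
    rewrite (_ : _ `&` _ = `]0, 1[%classic) ?lebesgue_measure_itv/= ?lte01 ?oppr0 ?adde0//.
    by apply/setIidr => q /=; rewrite !in_itv/= => /andP[_ /ltW].
  rewrite (_ : _ `&` _ = `]0, F x]%classic).
    rewrite lebesgue_measure_itv/= lte_fin lt_neqAle Fx0 andbT eq_sym.
    by have [->|_] := eqVneq (F x) 0; rewrite ?oppr0 ?adde0.
  apply/seteqP; split=> q /=; rewrite !in_itv/=.
    by move=> [-> /andP[-> _]].
  move=> /andP[-> qF]; split=> //.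
  by rewrite (le_lt_trans qF)// lt_neqAle Fx.
rewrite (eq_distribution_integral cdfH mg g0) integral_uniform01//.
  by apply: eq_integral => q /set_mem/=; rewrite in_itv/= => /HE ->.
exact: measurableT_comp.
Qed.

(** The sign [s] treats both tails at once: [s = -1] on []0, p[] and [s = 1] on []p, 1[]. The
    positive part of [s * (F^-1 - c)] lives on [D], so its integral over [D] is the expectation, and
    [s ^+ 2 = 1] recovers [F^-1] from it. *)
Lemma Rintegral_cdf_inv d (T : measurableType d) (P : probability T R)
    (X : {RV P >-> R}) (D : set R) (c s : R) :
  (forall x, cdf X x = (F x)%:E) ->
  measurable D -> D `<=` `]0, 1[ -> s ^+ 2 = 1 ->
  (forall q, D q -> 0 <= s * (cdf_inv F q - c)) ->
  (forall q, 0 < q < 1 -> ~ D q -> s * (cdf_inv F q - c) <= 0) ->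
  ('E_P[(fun t => Num.max (s * (X t - c)) 0)%R] < +oo)%E ->
  \int[mu]_(q in D) cdf_inv F q =
    c * fine (mu D) + s * fine 'E_P[(fun t => Num.max (s * (X t - c)) 0)%R]%E.
Proof.
move=> XF mD D01 s1 sD sND.
pose g x : R := Num.max (s * (x - c)) 0.
have mg : measurable_fun setT g.
  apply: measurable_maxr => //; apply: measurable_funM => //.
  exact: measurable_funB.
have ED : ('E_P[g \o X] = \int[mu]_(q in D) (s * (cdf_inv F q - c))%:E)%E.
  rewrite unlock (integral_cdf_inv (g := EFin \o g) XF)//; last 2 first.
  - exact/measurable_EFinP.
  - by move=> x; rewrite lee_fin le_max lexx orbT.
  rewrite integral_mkcond [RHS]integral_mkcond; apply: eq_integral => q _.
  rewrite !patchE; case: ifPn => [/set_mem q01|/negP q01].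
    case: ifPn => [/set_mem Dq|/negP Dq] /=.
      by rewrite /g max_l// sD.
    rewrite /g max_r//; apply: sND; first by move: q01; rewrite /= in_itv.
    by move=> Dq'; apply: Dq; rewrite inE.
  case: ifPn => // /set_mem Dq; exfalso; apply: q01; rewrite inE; exact: D01.
rewrite -[fun _ => _]/(g \o X) ED => Efin.
have mDf : measurable_fun D (cdf_inv F).
  exact: measurable_funS measurable_cdf_inv.
have muD : (mu D < +oo)%E.
  apply: (@le_lt_trans _ _ (mu (`]0, 1[ : set R))).
    by apply: le_measure; rewrite ?inE.
  by rewrite lebesgue_measure_itv/= lte01 oppr0 adde0 ltry.
have i1 : mu.-integrable D (EFin \o (fun q => s * (cdf_inv F q - c))).
  apply/integrableP; split.
    apply/measurable_EFinP; apply: measurable_funM => //.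
    exact: measurable_funB.
  (* On [D] the integrand is its own absolute value, so the finite expectation gives
     integrability. *)
  under eq_integral => q /set_mem Dq.
    rewrite /= ger0_norm ?sD//; over.
  exact: Efin.
have i2 : mu.-integrable D (EFin \o cst c).
  apply/integrableP; split; first exact/measurable_EFinP.
  by rewrite /= integral_cst// lte_mul_pinfty// lee_fin.
rewrite -RintegralZl//= -Rintegral_cst// -RintegralD//=.
  apply: eq_Rintegral => q _; rewrite mulrA -expr2 s1 mul1r; ring.
have := (fun mD' => integrableZl mD' s i1) mD.
by apply: eq_integrable => // q _; rewrite /= EFinM.
Qed.

End quantile_transform.

(** * The cross-over function in terms of expected positive parts *)

Section crossover_function.
Context (R : realType) (F : R -> R) (d : measure_display) (T : measurableType d)
  (P : probability T R) (X : {RV P >-> R}).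
Hypothesis F_inv : invertible01 F.
Hypothesis XF : forall x, cdf X x = (F x)%:E.
Local Notation mu := lebesgue_measure.

Lemma real_cdf_homo : {homo F : x y / x <= y}.
Proof. by move=> x y xy; rewrite -lee_fin -!XF cdf_nondecreasing. Qed.

(** The quantile transform gives [mu_l = c - E(c - X)^+ / p] and [mu_u = c + E(X - c)^+ / (1 - p)];
    the subtracted [2 * c] cancels the constants. *)
Lemma crossoverE p (c := cdf_inv F p) : 0 < p < 1 ->
  ('E_P[(fun t => Num.max (c - X t) 0)%R] < +oo)%E ->
  ('E_P[(fun t => Num.max (X t - c) 0)%R] < +oo)%E ->
  crossover F p = fine 'E_P[(fun t => Num.max (X t - c) 0)%R]%E / (1 - p)
    - fine 'E_P[(fun t => Num.max (c - X t) 0)%R]%E / p.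
Proof.
move=> p01; have /andP[p0 p1] := p01.
have F_nd := real_cdf_homo.
have -> : (fun t => Num.max (c - X t) 0) = (fun t => Num.max (-1 * (X t - c)) 0).
  by apply/funext => t; rewrite mulN1r opprB.
have -> : (fun t => Num.max (X t - c) 0) = (fun t => Num.max (1 * (X t - c)) 0).
  by apply/funext => t; rewrite mul1r.
move=> aoo boo.
rewrite /crossover /mu_l /mu_u -/c.
rewrite (Rintegral_cdf_inv F_inv F_nd XF _ _ _ _ _ aoo) ?sqrrN ?expr1n//; first last.
- move=> q q01 /negP; rewrite /= in_itv/= (andP q01).1/= -leNgt => pq.
  by rewrite mulN1r oppr_le0 subr_ge0 cdf_inv_homo.
- move=> q /=; rewrite in_itv/= => /andP[q0 qp].
  rewrite mulN1r oppr_ge0 subr_le0 cdf_inv_homo// ?(ltW qp)//.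
  by rewrite q0 (lt_trans qp).
- by move=> q /=; rewrite !in_itv/= => /andP[-> /lt_trans]; apply.
rewrite (Rintegral_cdf_inv F_inv F_nd XF _ _ _ _ _ boo) ?expr1n//; first last.
- move=> q q01 /negP; rewrite /= in_itv/= (andP q01).2/= andbT -leNgt => pq.
  by rewrite mul1r subr_le0 cdf_inv_homo.
- move=> q /=; rewrite in_itv/= => /andP[pq q1].
  rewrite mul1r subr_ge0 cdf_inv_homo// ?(ltW pq)//.
  by rewrite q1 (lt_trans p0).
- by move=> q /=; rewrite !in_itv/= => /andP[pq ->]; rewrite (lt_trans p0).
rewrite !lebesgue_measure_itv/= !lte_fin p0 p1 /=.
set a := fine _; set b := fine _.
field; rewrite gt_eqF//= gt_eqF// subr_gt0//.
Qed.

(** One bound covers every test function: the square dominates the positive parts, and the summand 1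
    dominates indicators. *)
Lemma sqr_dominated_expectation_lty (g : R -> R) c :
  (X : T -> R) \in Lfun P 2%:E ->
  measurable_fun setT g -> (forall x, g x ^+ 2 <= (x - c) ^+ 2 + 1) ->
  ('E_P[(fun t => g (X t) ^+ 2)%R] < +oo)%E.
Proof.
move=> X2 mg gle.
have Y2 : (X \- cst c : T -> R) \in Lfun P 2%:E.
  by rewrite rpredB ?lee1n//= Lfun_cst.
have Y1 : (fun t => (X t - c) ^+ 2) \in Lfun P 1.
  by apply/Lfun1_integrable; exact: Lfun2_integrable_sqr Y2.
have Z1 : ((fun t => (X t - c) ^+ 2) \+ cst 1) \in Lfun P 1.
  by rewrite rpredD//= Lfun_cst.
have := expectation_fin_num Z1; rewrite ge0_fin_numE; last first.
  by apply: expectation_ge0 => t; rewrite /= addr_ge0 ?sqr_ge0.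
apply: le_lt_trans; apply: expectation_le.
- by apply: measurable_funX; exact: measurableT_comp.
- by move: Z1; rewrite inE => /andP[]; rewrite inE.
- by move=> t; rewrite sqr_ge0.
- by move=> t; rewrite /= addr_ge0 ?sqr_ge0.
- by apply: aeW => t /=; exact: gle.
Qed.

End crossover_function.

(** * Convergence in probability, by a union bound over four deviation events *)

Theorem theorem1 (d : measure_display) (T : measurableType d) (R : realType)
    (P : probability T R) (W : nat -> {RV P >-> R}) (F f : R -> R)
    (W_indep : mutually_independent W)
    (W_cdf : forall i x, cdf (W i) x = (F x)%:E)
    (F_inv : invertible01 F)
    (F_dens : abs_continuous_with_density F f)
    (W_sqr : ('E_P[(fun t => (W 0%N t) ^+ 2)%R] < +oo)%E)
    (p : R) (hp : 0 < p < 1) :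
  cvg_in_probability P
    (fun n t => ecf n (fun i => W i t) p) (fun _ => crossover F p).
Proof.
have F_nd := real_cdf_homo (W_cdf 0%N).
pose c := cdf_inv F p.
have W2 : (W 0%N : T -> R) \in Lfun P 2%:E by exact: Lfun2_sqr_lty.
pose gl (x : R) : R := Num.max (c - x) 0.
pose gu (x : R) : R := Num.max (x - c) 0.
pose gi (y x : R) := (x <= y)%R%:R : R.
have mgl : measurable_fun setT gl.
  by apply: measurable_maxr => //; exact: measurable_funB.
have mgu : measurable_fun setT gu.
  by apply: measurable_maxr => //; exact: measurable_funB.
have mgi y : measurable_fun setT (gi y).
  have -> : gi y = \1_(`]-oo, y]%classic) by apply/funext => x; exact: le_indicE.
  exact: measurable_indic.
have gl0 x : 0 <= gl x by rewrite le_max lexx orbT.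
have gu0 x : 0 <= gu x by rewrite le_max lexx orbT.
have gi0 y x : 0 <= gi y x by exact: ler0n.
have gl2 : ('E_P[(fun t => gl (W 0%N t) ^+ 2)%R] < +oo)%E.
  apply: (@sqr_dominated_expectation_lty _ _ _ _ _ _ c) => // x.
  rewrite /gl; case: (leP (c - x) 0) => _.
    by rewrite expr0n/= addr_ge0 ?sqr_ge0.
  by rewrite -sqrrN opprB lerDl.
have gu2 : ('E_P[(fun t => gu (W 0%N t) ^+ 2)%R] < +oo)%E.
  apply: (@sqr_dominated_expectation_lty _ _ _ _ _ _ c) => // x.
  rewrite /gu; case: (leP (x - c) 0) => _.
    by rewrite expr0n/= addr_ge0 ?sqr_ge0.
  by rewrite lerDl.
have gi2 y : ('E_P[(fun t => gi y (W 0%N t) ^+ 2)%R] < +oo)%E.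
  apply: (@sqr_dominated_expectation_lty _ _ _ _ _ _ c) => // x.
  have := sqr_ge0 (x - c).
  by rewrite /gi; case: (x <= y); rewrite /= ?mulr1n ?mulr0n; lra.
have mW i : measurable_fun setT (W i) by [].
(* On a probability space, square integrability implies integrability. *)
have Elt (g : R -> R) : measurable_fun setT g ->
    ('E_P[(fun t => g (W 0%N t) ^+ 2)%R] < +oo)%E -> ('E_P[g \o W 0%N] < +oo)%E.
  move=> mg g2.
  have /Lfun2_sqr_lty : measurable_fun setT (g \o W 0%N) by exact: measurableT_comp.
  move=> /(_ _ g2) h; rewrite ltey_eq; apply/orP; left.
  by rewrite expectation_fin_num// Lfun_subset12// fin_num_measure.
have Egi y : fine 'E_P[gi y \o W 0%N]%E = F y.
  have -> : gi y \o W 0%N = \1_(W 0%N @^-1` `]-oo, y]).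
    by apply/funext => t; rewrite /gi/= le_indicE.
  rewrite expectation_indic; first exact: (congr1 fine (W_cdf 0%N y)).
  by rewrite -[X in measurable X]setTI; exact: mW.
move=> e e0.
rewrite (crossoverE F_inv (W_cdf 0%N) hp (Elt _ mgl gl2) (Elt _ mgu gu2)).
rewrite -/c -/(gl \o W 0%N) -/(gu \o W 0%N).
set a := fine 'E_P[gl \o _]%E; set b := fine 'E_P[gu \o _]%E.
have [r r0 rP] := ecf_near a b hp e0.
have Fu : p < F (c + r) by rewrite (cdf_gt_above F_inv)// ltrDl.
have Fl : F (c - r) < p by rewrite (cdf_lt_below F_inv)// gtrBl.
(* Half the upper gap leaves the empirical distribution function at [c + r] at least [p + s] after a
   deviation below [s]. At [c - r] only the bound [p] is required, so the full gap can be used. *)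
pose s := Num.min ((F (c + r) - p) / 2) (p - F (c - r)).
have s0 : 0 < s by rewrite lt_min divr_gt0 ?subr_gt0.
pose bad (g : R -> R) (m x : R) n : set T :=
  [set t | x <= `|n%:R^-1 * (\sum_(i < n) g (W i t)) - m|].
have mbad g m x n : measurable_fun setT g -> measurable (bad g m x n).
  move=> mg; rewrite -[X in measurable X]setTI.
  apply: measurable_fun_le => //; apply: measurableT_comp => //.
  apply: measurable_funB => //; apply: measurable_funM => //.
  by apply: measurable_sum => i; exact: measurableT_comp.
have wl := iid_weak_law W_indep W_cdf mgl gl0 gl2 r0.
have wu := iid_weak_law W_indep W_cdf mgu gu0 gu2 r0.
have wi y := iid_weak_law W_indep W_cdf (mgi y) (gi0 y) (gi2 y) s0.
rewrite -/a in wl; rewrite -/b in wu.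
have wi1 := wi (c + r); have wi2 := wi (c - r).
rewrite Egi in wi1; rewrite Egi in wi2.
pose B1 := bad gl a r; pose B2 := bad gu b r.
pose B3 := bad (gi (c + r)) (F (c + r)) s.
pose B4 := bad (gi (c - r)) (F (c - r)) s.
(* Outside [B n] the two means are within [r] of their limits, and the empirical distribution
   function at [c - r] and [c + r] confines both order statistics to within [r] of [c]. For large
   [n] the ECF is then within [e] of its limit. *)
pose B n := B1 n `|` B2 n `|` B3 n `|` B4 n.
have lim : (P (B1 n) + P (B2 n) + P (B3 n) + P (B4 n))%E @[n --> \oo] --> 0%E.
  rewrite (_ : 0%E = 0 + 0 + 0 + 0)%E; last by rewrite !adde0.
  apply: cvgeD => //; apply: cvgeD => //; exact: cvgeD.
have ns := order_stat_near r hp s0.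
apply: (squeeze_cvge _ (cvg_cst 0%E) lim).
near=> n; rewrite measure_ge0/=.
have mB1 : measurable (B1 n) by exact: mbad.
have mB2 : measurable (B2 n) by exact: mbad.
have mB3 : measurable (B3 n) by exact: mbad.
have mB4 : measurable (B4 n) by exact: mbad.
apply: (@le_trans _ _ (P (B n))).
  apply: le_measure; rewrite ?inE.
  - rewrite -[X in measurable X]setTI; apply: measurable_fun_le => //.
    apply: measurableT_comp => //; apply: measurable_funB => //.
    exact: measurable_ecf.
  - by do ![apply: measurableU => //].
  - move=> t /= et; apply/not_notP => /not_orP[/not_orP[/not_orP[]]].
    move=> /negP; rewrite -ltNge => h1 /negP; rewrite -ltNge => h2.
    move=> /negP; rewrite -ltNge => h3 /negP; rewrite -ltNge => h4.
    have [] : `|order_stat n (W ^~ t) (ecf_index n p) - c| <= r /\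
        `|order_stat n (W ^~ t) (ecf_index n p).+1 - c| <= r.
      apply: (near ns n) => //=.
        have : s <= (F (c + r) - p) / 2 by rewrite ge_min lexx.
        move: h3; rewrite /gi ltr_norml => /andP[].
        set N := n%:R^-1 * _; lra.
      have : s <= p - F (c - r) by rewrite ge_min lexx orbT.
      move: h4; rewrite /gi ltr_norml => /andP[].
      by set N := n%:R^-1 * _; lra.
    move=> h5 h6; move: et; apply/negP; rewrite -ltNge.
    by apply: (near rP n) h5 h6.
apply: (le_trans (measureU2 _ _ _)) => //; first by do ![apply: measurableU => //].
rewrite leeD2r//; apply: (le_trans (measureU2 _ _ _)) => //; first exact: measurableU.
by rewrite leeD2r//; exact: measureU2.
Unshelve. all: by end_near. Qed.
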